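(* Let $G$ be a finite graph and let $u,v$ be vertices of $G$. In the independent set toggle group $T(\mathcal{IS}(G))$, $(t_ut_v)^2=1$ if and only if there is no edge between $u$ and $v$ in $G$.
   Context: An independent set in a graph $G$ is a subset of the vertices such that no two have an edge between them; $\mathcal{IS}(G)\subseteq 2^{V(G)}$ is the set of independent sets. For $v\in V(G)$ the toggle $t_v:\mathcal{IS}(G)\to\mathcal{IS}(G)$ is given by $t_v(X)=X\cup\{v\}$ if $v\notin X$ and $X\cup\{v\}\in\mathcal{IS}(G)$; $t_v(X)=X\setminus\{v\}$ if $v\in X$ and $X\setminus\{v\}\in\mathcal{IS}(G)$; and $t_v(X)=X$ otherwise. $T(\mathcal{IS}(G))$ is the subgroup of the symmetric group on $\mathcal{IS}(G)$ generated by all $t_v$, $v\in V(G)$. *)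

(* Defs.v *)
From mathcomp Require Import all_boot all_fingroup.

Set Implicit Arguments.
Unset Strict Implicit.
Unset Printing Implicit Defensive.

Import GroupScope.

(* A finite simple graph is given by its vertex set T : finType and its
   adjacency relation e : rel T, assumed symmetric and irreflexive where
   needed. *)

Definition independent (T : finType) (e : rel T) (X : {set T}) : bool :=
  [forall x in X, forall y in X, ~~ e x y].

Definition indset (T : finType) (e : rel T) : finType :=
  {X : {set T} | independent e X}.

(* [insubd X Y] is Y when Y is independent, and X otherwise. *)
Definition toggle_fun (T : finType) (e : rel T) (v : T) (X : indset e) :
    indset e :=
  if v \notin val X then insubd X (v |: val X) else insubd X (val X :\ v).

Lemma val_toggle_fun (T : finType) (e : rel T) (v : T) (X : indset e) :
  val (toggle_fun v X) =
    let Y := if v \notin val X then v |: val X else val X :\ v in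
    if independent e Y then Y else val X.
Proof. by rewrite /toggle_fun; case: ifP => _; rewrite /= val_insubd. Qed.

Lemma toggle_funK (T : finType) (e : rel T) (v : T) :
  involutive (@toggle_fun T e v).
Proof.
move=> X; apply: val_inj; rewrite val_toggle_fun val_toggle_fun /=.
have iX : independent e (val X) := valP X.
have [vX | vX] /= := boolP (v \in val X).
  have [iY | niY] := boolP (independent e (val X :\ v)).
    by rewrite setD11 setD1K // iX.
  by rewrite vX (negPf niY).
have [iY | niY] := boolP (independent e (v |: val X)).
  by rewrite setU11 setU1K // iX.
by rewrite vX (negPf niY).
Qed.

Definition toggle (T : finType) (e : rel T) (v : T) : {perm indset e} :=
  perm (inv_inj (@toggle_funK T e v)).

Definition toggle_group (T : finType) (e : rel T) : {group {perm indset e}} :=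
  <<[set toggle e v | v : T]>>%G.

Lemma mem_toggle_group (T : finType) (e : rel T) (v : T) :
  toggle e v \in toggle_group e.
Proof. by apply: mem_gen; apply: imset_f. Qed.

(* The toggle at v as an element of the group T(IS(G)). The product of
   permutations is composed from left to right: s * t maps X to t (s X). *)
Definition tog (T : finType) (e : rel T) (v : T) : [subg toggle_group e] :=
  Subg (mem_toggle_group e v).

(* Main.v *)
Require Import Defs.
From mathcomp Require Import all_boot all_fingroup.

Set Implicit Arguments.
Unset Strict Implicit.
Unset Printing Implicit Defensive.

Import GroupScope.

(* Whether [v] lies in the image of [X] under the toggle at [v] depends only on
   [v \in X] and on the neighbours of [v] in [X]; a toggle at a non-neighbour
   [u <> v] changes neither, so the two toggles commute, and both are
   involutions. If [u] and [v] are adjacent, the word [t_u t_v t_u t_v] takes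
   the empty set through {u}, {u}, {} to {v}. *)

Lemma independentP (T : finType) (e : rel T) (X : {set T}) :
  reflect {in X &, forall x y, ~~ e x y} (independent e X).
Proof.
apply: (iffP forall_inP) => [h x y xX yX | h x xX].
  exact: (forall_inP (h x xX)).
by apply/forall_inP => y yX; apply: h.
Qed.

Lemma independent0 (T : finType) (e : rel T) : independent e set0.
Proof. by apply/independentP => x y; rewrite inE. Qed.

Lemma independentS (T : finType) (e : rel T) (X Y : {set T}) :
  Y \subset X -> independent e X -> independent e Y.
Proof.
move=> /subsetP sYX /independentP iX; apply/independentP => x y xY yY.
by apply: iX; apply: sYX.
Qed.

(** Any new edge meets [v]: irreflexivity rules out a loop there, and symmetry makes one orientation
    of each pair enough. *)
Lemma independentU1 (T : finType) (e : rel T)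
    (e_sym : symmetric e) (e_irr : irreflexive e) (v : T) (X : {set T}) :
  independent e X ->
  independent e (v |: X) = [forall y in X, ~~ e v y].
Proof.
move=> /independentP iX; apply/independentP/forall_inP => [h y yX | h x y].
  by apply: h; rewrite !inE ?eqxx ?yX ?orbT.
rewrite !inE => /predU1P[-> | xX] /predU1P[-> | yX].
- by rewrite e_irr.
- exact: h.
- by rewrite e_sym h.
- exact: iX.
Qed.

(** Deletion never fails, because subsets of independent sets are independent; only insertion
    carries a condition on neighbours. *)
Lemma in_toggle (T : finType) (e : rel T)
    (e_sym : symmetric e) (e_irr : irreflexive e) (v x : T) (X : indset e) :
  (x \in val (toggle e v X)) =
    if x == v then (v \notin val X) && [forall y in val X, ~~ e v y]
    else x \in val X.
Proof.
have iX : independent e (val X) := valP X.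
rewrite permE val_toggle_fun /=.
have [vX | vX] /= := boolP (v \in val X).
  by rewrite (independentS (subD1set _ _) iX) !inE; case: eqP.
rewrite independentU1 //; case: ifP => _; rewrite ?inE; case: eqP => // ->.
exact: negbTE.
Qed.

Lemma toggleK (T : finType) (e : rel T) (v : T) : toggle e v * toggle e v = 1.
Proof. by apply/permP => X; rewrite permM perm1 !permE toggle_funK. Qed.

Lemma toggle_comm (T : finType) (e : rel T)
    (e_sym : symmetric e) (e_irr : irreflexive e) (u v : T) :
  ~~ e u v -> commute (toggle e u) (toggle e v).
Proof.
move=> nuv; have [-> // | neq_uv] := eqVneq u v.
have nbr a b X : a != b -> ~~ e a b ->
    [forall y in val (toggle e b X), ~~ e a y]
      = [forall y in val X, ~~ e a y].
  move=> neq_ab nab; apply: eq_forallb => y; rewrite in_toggle //.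
  (* Only the membership of [b] can differ, and at [y = b] both implications hold through their
     conclusion [~~ e a b]. *)
  by case: eqP => // ->; rewrite nab !implybT.
apply/permP => X; apply/val_inj/setP => x; rewrite !permM !(in_toggle _ _ _ x) //.
have [-> | _] := eqVneq x u.
  by rewrite (negPf neq_uv) nbr // in_toggle // (negPf neq_uv).
have [_ | //] := eqVneq x v.
by rewrite nbr ?in_toggle // 1?e_sym // eq_sym (negPf neq_uv).
Qed.

Lemma toggle_adj_neq1 (T : finType) (e : rel T)
    (e_sym : symmetric e) (e_irr : irreflexive e) (u v : T) :
  e u v -> (toggle e u * toggle e v) ^+ 2 != 1.
Proof.
move=> euv; have neq_uv : u != v by apply: contraTneq euv => ->; rewrite e_irr.
pose X0 : indset e := Sub set0 (independent0 e).
have inX1 w x : (x \in val (toggle e w X0)) = (x == w).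
  rewrite in_toggle // !inE /=; case: eqP => // _.
  by apply/forall_inP => y; rewrite inE.
have X2 : toggle e v (toggle e u X0) = toggle e u X0.
  apply/val_inj/setP => x; rewrite in_toggle // !inX1.
  have [-> | //] := eqVneq x v; rewrite [v == u]eq_sym (negPf neq_uv).
  by apply/forall_inPn; exists u; rewrite ?inX1 // negbK e_sym.
apply/eqP => /permP /(_ X0).
(* By [X2] the first [toggle e v] fixes its argument, so the two [toggle e u] meet and cancel,
   leaving [toggle e v X0 = X0]. *)
rewrite expgS expg1 !permM X2 -(permM (toggle e u) (toggle e u)) toggleK !perm1.
by move=> eqX0; have := inX1 v v; rewrite eqX0 inE eqxx.
Qed.

Theorem lemma3p23 (T : finType) (e : rel T)
    (e_sym : symmetric e) (e_irr : irreflexive e) (u v : T) :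
  (tog e u * tog e v) ^+ 2 = 1 <-> ~~ e u v.
Proof.
split=> [/(congr1 val) /= h | nuv].
  by apply/negP => /(toggle_adj_neq1 e_sym e_irr) /eqP.
(* The projection from the subgroup commutes with products and powers by conversion, so the
   computation moves to permutations. *)
apply: val_inj; rewrite -[LHS]/((toggle e u * toggle e v) ^+ 2).
rewrite (expgMn _ (toggle_comm e_sym e_irr nuv)).
by rewrite !expgS !expg0 !mulg1 !toggleK mulg1.
Qed.
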